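(* Let $\mathcal{X}$ be a finite set, $U:\mathcal{X}\to\mathbb{R}$ with $\min_xU(x)=0$, and $Q$ the generator of an ergodic continuous-time Markov chain on $\mathcal{X}$ reversible with respect to its stationary distribution $\pi$. Suppose $c_{M_2}>0$. Let $A>0$ be a constant as in the spectral gap bound recalled in the context, put $$\rho:=\frac{2c_{M_2}A}{3R},\qquad T(t)=\frac{c_{M_2}}{\log(\rho t+1)},$$ and let $X^{M_2}$ be the non-homogeneous continuous-time Markov chain with generators $(M_{2,t})_{t\ge0}$. Then for every $x\in\mathcal{X}$ and $t\ge0$, $$\mathbb{P}_x(X^{M_2}_t\notin U_{min})\leq 5K(\rho t+1)^{-\frac{B}{c_{M_2}}}+\left(\pi(x)^{-1}-1\right)^{1/2}K^{1/2}(\rho t+1)^{-\frac{R+B/2}{c_{M_2}}}.$$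
   Context: $\mathcal{X}$ has at least two points. Reversibility: $\pi(x)Q(x,y)=\pi(y)Q(y,x)$ for all $x,y$. For $x\neq y$, $M_{2,t}(x,y)=Q(x,y)\max\{1,e^{(U(x)-U(y))/T(t)}\}=Q(x,y)e^{(U(x)-U(y))_+/T(t)}$ (with $a_+=\max\{a,0\}$), and $M_{2,t}(x,x)=-\sum_{z\neq x}M_{2,t}(x,z)$; at $t=0$, $1/T(0)$ is read as $0$. $\mathbb{P}_x$ is the law of the chain with these time-dependent generators started at $x$ at time $0$. $U_{min}=\{x: U(x)=\min_yU(y)\}$ with complement $U_{min}^c$; $R=\max_xU(x)-\min_xU(x)$; $K=\pi(U_{min})^{-1}-1$; $B=\min_{x\in U_{min}^c}U(x)-\min_xU(x)$. A path from $x$ to $y$ is a sequence $\gamma=(\gamma_i)_{i=0}^n$ with $\gamma_0=x$, $\gamma_n=y$ and $Q(\gamma_{i-1},\gamma_i)>0$ for $i=1,\ldots,n$; $\Gamma^{x,y}$ is the set of such paths. $\mathrm{Elev}_2(\gamma)=\max_{1\le i\le n}\min\{U(\gamma_{i-1}),U(\gamma_i)\}$, $H_2(x,y)=\min_{\gamma\in\Gamma^{x,y}}\mathrm{Elev}_2(\gamma)$, and $c_{M_2}=\max_{x\neq y}\{H_2(x,y)-U(x)-U(y)\}$. The constant $A>0$: $A$ depends only on $Q$ and $U$ (not on the cooling schedule) and satisfies $\lambda_2(-M_{2,t})\geq A\exp\{-c_{M_2}/T(t)\}$ for all $t\ge0$ and every cooling schedule $T$ (positive, decreasing to $0$). Here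 $\lambda_2(-M_{2,t})$ is the spectral gap (second smallest eigenvalue of $-M_{2,t}$), where $M_{2,t}$ is reversible with respect to the Gibbs distribution $\pi_{T(t)}(x)\propto e^{-U(x)/T(t)}\pi(x)$. Such a constant exists. *)

(* Defs.v *)
From HB Require Import structures.
From mathcomp Require Export all_boot all_order all_algebra.
From mathcomp Require Export all_classical all_reals all_analysis.
Export Order.TTheory GRing.Theory Num.Theory.
Export numFieldNormedType.Exports.
Set Implicit Arguments.
Unset Strict Implicit.
Unset Printing Implicit Defensive.
Local Open Scope classical_set_scope.
Local Open Scope ring_scope.

(* Maximum and minimum of a nonempty finite sequence of values; by convention
   they are 0 on the empty sequence. *)
Definition seqmax (R : realType) (s : seq R) : R :=
  \big[Num.max/head 0 s]_(a <- s) a.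
Definition seqmin (R : realType) (s : seq R) : R :=
  \big[Num.min/head 0 s]_(a <- s) a.

Section Landscape.
Variables (R : realType) (X : finType) (U : X -> R) (Q : X -> X -> R).

Definition minU : R := seqmin [seq U x | x : X].
Definition maxU : R := seqmax [seq U x | x : X].

Definition Umin : {set X} := finset (fun x : X => U x == minU).

Definition range_U : R := maxU - minU.

Definition gap_U : R := seqmin [seq U x | x in (~: Umin)%SET] - minU.

(* A path gamma_0, ..., gamma_n is encoded as its starting point gamma_0 and
   the sequence [:: gamma_1; ...; gamma_n]. *)
Definition Qpaths (x y : X) : set (seq X) :=
  [set p | path (fun a b => 0 < Q a b) x p /\ last x p = y].

(* zip (x :: p) p lists the pairs (gamma_(i-1), gamma_i), 1 <= i <= n. *)
Definition elev2 (x : X) (p : seq X) : R :=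
  seqmax [seq Num.min (U e.1) (U e.2) | e <- zip (x :: p) p].

(* For x != y the elevation takes finitely many values (all of them values of
   U), so this infimum over the paths is a minimum when some path exists. *)
Definition H2 (x y : X) : R := inf [set elev2 x p | p in Qpaths x y].

Definition cM2 : R :=
  seqmax [seq H2 e.1 e.2 - U e.1 - U e.2 | e in [pred e : X * X | e.1 != e.2]].

End Landscape.

Section Generators.
Variables (R : realType) (X : finType).

Definition is_generator (Q : X -> X -> R) : Prop :=
  (forall x y, x != y -> 0 <= Q x y) /\ (forall x, \sum_y Q x y = 0).

(* On a finite state space, a continuous-time chain is ergodic if and only if
   it is irreducible. *)
Definition irreducible (Q : X -> X -> R) : Prop :=
  forall x y, exists p, Qpaths Q x y p.

Definition is_distribution (pi : X -> R) : Prop :=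
  (forall x, 0 <= pi x) /\ \sum_x pi x = 1.

Definition is_stationary (Q : X -> X -> R) (pi : X -> R) : Prop :=
  is_distribution pi /\ forall y, \sum_x pi x * Q x y = 0.

Definition is_reversible (Q : X -> X -> R) (pi : X -> R) : Prop :=
  forall x y, pi x * Q x y = pi y * Q y x.

Definition K_of (U : X -> R) (pi : X -> R) : R :=
  (\sum_(x in Umin U) pi x)^-1 - 1.

Definition mx_of (M : X -> X -> R) : 'M[R]_#|X| :=
  \matrix_(i, j) M (enum_val i) (enum_val j).

End Generators.

(* Nondecreasing list of the eigenvalues, repeated according to algebraic
   multiplicity, of a real matrix whose characteristic polynomial splits over
   R (such a list is then unique); this is the case of every generator that is
   reversible with respect to a positive distribution. *)
Definition eigenvalues (R : realType) (n : nat) (A : 'M[R]_n) : seq R :=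
  xget [::] [set s : seq R | sorted <=%R s /\
                             char_poly A = \prod_(a <- s) ('X - a%:P)].

Definition lambda2 (R : realType) (n : nat) (A : 'M[R]_n) : R :=
  nth 0 (eigenvalues A) 1.

Section Annealing.
Variables (R : realType) (X : finType) (U : X -> R) (Q : X -> X -> R).

(* Temperatures live in ]0, +oo]: an infinite temperature is allowed, so that
   c / log (rho t + 1) makes sense at t = 0.  By strict monotonicity only T 0
   can be infinite. *)
Definition cooling_schedule (T : R -> \bar R) : Prop :=
  [/\ forall t, 0 <= t -> (0 < T t)%E,
      forall s t, 0 <= s -> s < t -> (T t < T s)%E
    & T t @[t --> +oo%R] --> 0%E].

(* 1 / T(t), which is 0 where T(t) = +oo. *)
Definition inv_temp (T : R -> \bar R) (t : R) : R := fine ((T t)^-1)%E.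

Definition M2 (T : R -> \bar R) (t : R) (x y : X) : R :=
  let rate a b := Q a b * Num.max 1 (expR ((U a - U b) * inv_temp T t)) in
  if x == y then - \sum_(z | z != x) rate x z else rate x y.

Definition spectral_gap_constant (A : R) : Prop :=
  0 < A /\
  forall T, cooling_schedule T -> forall t, 0 <= t ->
    A * expR (- cM2 U Q * inv_temp T t) <= lambda2 (- mx_of (M2 T t)).

End Annealing.

Section NonHomogeneousChain.
Variables (R : realType) (X : finType).

(* p s t x y is the probability to be in y at time t given x at time s, for
   0 <= s <= t: the solution of the Kolmogorov forward equation
   d/dt p(s,t) = p(s,t) M_t with p(s,s) = id, for t |-> M_t continuous. *)
Definition transition_function (M : R -> X -> X -> R)
    (p : R -> R -> X -> X -> R) : Prop :=
  forall s x y, 0 <= s ->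
    [/\ p s s x y = (x == y)%:R,
        {within `[s, +oo[, continuous (fun t => p s t x y)}
      & forall t, s < t ->
          is_derive t 1 (fun u : R => p s u x y)
            (\sum_z p s t x z * M t z y)].

(* The finite-dimensional distributions: l is a list of (time, state) pairs
   with nondecreasing nonnegative times. The list [:: (0, x)] says that the
   chain starts at x almost surely. *)
Definition is_markov_chain (M : R -> X -> X -> R) (x : X)
    (d : measure_display) (Omega : measurableType d) (P : probability Omega R)
    (Z : R -> Omega -> X) : Prop :=
  (forall t y, 0 <= t -> measurable [set w | Z t w = y]) /\
  exists p, transition_function M p /\
    forall l : seq (R * X), path (fun a b => a.1 <= b.1) (0, x) l ->
      P [set w | forall q, q \in l -> Z q.1 w = q.2] =
      (\prod_(e <- zip ((0, x) :: l) l) p e.1.1 e.2.1 e.1.2 e.2.2)%:E.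

End NonHomogeneousChain.

(* Main.v *)
Require Import Defs.
From mathcomp Require Import complex.
From mathcomp Require Import ring lra.
Set Implicit Arguments.
Unset Strict Implicit.
Unset Printing Implicit Defensive.
Local Open Scope classical_set_scope.
Local Open Scope ring_scope.

(** The law mu_t of the chain is compared with the Gibbs distribution p_t at
    the current inverse temperature b(t) = ln (rho t + 1) / c through the
    chi-square distance h(t) = sum_x mu_t(x)^2 / p_t(x) - 1.

    Its derivative has two parts.  The motion of the chain at a fixed
    temperature contributes minus twice a Dirichlet form, at most
    -2 lambda_2 h because the generator is reversible for p_t
    ([chi2_dissipation], which rests on the variational property of the second
    eigenvalue, [symmetric_gap] and [reversible_gap]).  The motion of p_t
    contributes at most b' (R h + 2 sqrt(h) sqrt(E_p U^2)) ([chi2_drift]).  The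
    rate rho is chosen so that lambda_2 >= A / (rho t + 1) = (3/2) R b', hence
    h' <= 2 b' (- R h + sqrt(h) sqrt(E_p U^2)); and since U vanishes on the
    ground states, E_p U^2 is at most R^2 times the Gibbs mass of the other
    states, itself at most K exp(-b B) ([gibbs_tail]).

    So u = sqrt h satisfies u' <= b' (- R u + R sqrt(K) exp(-b B / 2)).  Since
    B <= R, this integrates to
    u <= exp(-R b) u(0) + 2 sqrt(K) exp(-b B / 2) ([sqrt_gronwall]), where
    u(0)^2 = 1 / pi(x) - 1 because b(0) = 0.  Finally Cauchy-Schwarz bounds
    the mass that mu_t gives to the excited states by
    p_t(excited) + u sqrt(p_t(excited)), which yields the announced inequality
    with 3 K in place of 5 K ([annealing_escape]). *)

(** * Second eigenvalue of a real symmetric matrix *)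
Lemma char_poly_similar (F : fieldType) n (P A B : 'M[F]_n) :
  P \in unitmx -> P *m A = B *m P -> char_poly A = char_poly B.
Proof.
move=> Pu PA.
pose Pp := map_mx polyC P.
have PpA : Pp *m char_poly_mx A = char_poly_mx B *m Pp.
  rewrite /char_poly_mx mulmxBr mulmxBl -!map_mxM PA.
  by rewrite mul_mx_scalar mul_scalar_mx.
have : \det Pp * char_poly A = char_poly B * \det Pp by rewrite -!det_mulmx PpA.
rewrite det_map_mx [RHS]mulrC; apply: mulfI.
by rewrite polyC_eq0 -unitfE -unitmxE.
Qed.

Local Notation "M ^t*" := (map_mx Num.conj (trmx M)) (at level 30).

(** The spectral theorem over the complex extension R[i]: the eigenvalues of a
    Hermitian matrix are real, so the characteristic polynomial already splits
    over R, as the definition of [eigenvalues] demands. *)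
Lemma symmetric_diagonalization (R : realType) n (S : 'M[R]_n) : S^T = S ->
  exists2 P : 'M[R[i]]_n, P \is unitarymx & exists2 d : 'I_n -> R,
    map_mx (real_complex R) S
      = P^t* *m diag_mx (\row_j real_complex R (d j)) *m P &
    char_poly S = \prod_j ('X - (d j)%:P).
Proof.
move=> Ssym; pose SC := map_mx (real_complex R) S.
have SCsym : SC \is symmetricmx.
  by apply/is_hermitianmxP; rewrite expr0 scale1r map_mx_id // /SC map_trmx Ssym.
have SCherm : SC \is hermsymmx.
  apply: realsym_hermsym => //.
  by apply/mxOverP => i j; rewrite mxE; apply/complex_realP; exists (S i j).
have /mxOverP dreal := hermitian_spectral_diag_real SCherm.
have /hermitian_normalmx/orthomx_spectralP SCE := SCherm.
have Pun := spectral_unitarymx SC.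
exists (spectralmx SC) => //.
exists (fun j => complex.Re (spectral_diag SC 0 j)).
  suff <- : spectral_diag SC = \row_j real_complex R (complex.Re (spectral_diag SC 0 j)).
    by rewrite -(invmx_unitary Pun); exact: SCE.
  apply/rowP => j; rewrite !mxE.
  by have /complex_realP[k ->] := dreal 0 j.
apply: (@map_poly_inj _ _ (real_complex R)).
rewrite map_char_poly -/SC.
rewrite (@char_poly_similar _ _ (spectralmx SC) _ (diag_mx (spectral_diag SC))); last first.
- by rewrite {2}SCE !mulmxA mulmxV ?mul1mx // unitarymx_unit.
- exact: unitarymx_unit.
rewrite char_poly_trig ?diag_mx_is_trig // rmorph_prod; apply: eq_bigr => j _.
rewrite rmorphB /= map_polyX map_polyC /= mxE eqxx mulr1n.
by have /complex_realP[k ->] := dreal 0 j.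
Qed.

(** A factorization of the characteristic polynomial determines the multiset
    of roots; j0 is an index at which d takes the smallest one.  Positivity of
    [lambda2] guarantees that the list has a second entry, the default value
    of [nth] being 0. *)
Lemma lambda2_le_all_but_one (R : realType) n (A : 'M[R]_n) (d : 'I_n -> R) :
  char_poly A = \prod_j ('X - (d j)%:P) -> 0 < lambda2 A ->
  exists j0, forall j, j != j0 -> lambda2 A <= d j.
Proof.
move=> charA; rewrite /lambda2 /eigenvalues.
case: xgetP => [s sE [ssort sA]|nos]; last by rewrite nth_nil ltxx.
have : perm_eq s [seq d j | j <- enum 'I_n].
  apply: prod_XsubC_eq; rewrite -sA charA big_map big_enum.
  by apply: eq_bigr.
case: s ssort {sE sA} => [|a [|b s]] /=; rewrite ?ltxx // => /andP[_ bs] ps b0.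
have : a \in [seq d j | j <- enum 'I_n] by rewrite -(perm_mem ps) mem_head.
move=> /mapP[j0 _ aE]; exists j0 => j jj0.
move: ps; rewrite aE.
rewrite perm_sym (permPl (perm_map d (perm_to_rem (mem_enum _ j0)))).
rewrite perm_cons => /perm_mem/(_ (d j)) djE.
have : d j \in b :: s.
  by rewrite -djE map_f // mem_rem_uniq ?enum_uniq // !inE jj0 mem_enum.
rewrite inE => /orP[/eqP->//|].
by move: (order_path_min le_trans bs) => /allP/[apply].
Qed.

Lemma ler_real_complex (R : realType) (a b : R) :
  (real_complex R a <= real_complex R b) = (a <= b).
Proof. exact: lecR. Qed.

Lemma row_dotE (C : numClosedFieldType) n (a b : 'rV[C]_n) :
  (a *m b^t*) 0 0 = \sum_j a 0 j * Num.conj (b 0 j).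
Proof. by rewrite mxE; apply: eq_bigr => j _; rewrite !mxE. Qed.

(** In the eigenbasis, all eigenvalues but that of index j0 are at least
    lambda_2 > 0.  A kernel vector v is therefore supported on j0, and a vector
    u orthogonal to v has no component there. *)
Lemma symmetric_gap (R : realType) n (S : 'M[R]_n) (u v : 'rV[R]_n) :
  S^T = S -> v != 0 -> v *m S = 0 -> u *m v^T = 0 -> 0 < lambda2 S ->
  lambda2 S * (u *m u^T) 0 0 <= (u *m S *m u^T) 0 0.
Proof.
move=> Ssym v0 vS uv l0.
have [P Pun [d SE charS]] := symmetric_diagonalization Ssym.
have [j0 ld] := lambda2_le_all_but_one charS l0.
(* coordinates of u and v in the eigenbasis *)
pose y := map_mx (real_complex R) u *m P^t*.
pose w := map_mx (real_complex R) v *m P^t*.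
have PtP : P^t* *m P = 1%:M by rewrite -invmx_unitary // mulVmx // unitarymx_unit.
have adj (x : 'rV[R]_n) : map_mx (real_complex R) x^T = P^t* *m (map_mx (real_complex R) x *m P^t*)^t*.
  rewrite trmx_mul map_mxM mulmxA trmxCK PtP mul1mx -map_trmx.
  by apply/matrixP => i j; rewrite !mxE; apply/esym/conj_Creal/complex_realP; exists (x j i).
have PPt : P *m P^t* = 1%:M by apply/eqP.
have wj j : j != j0 -> w 0 j = 0.
  move=> jj0; have : w *m diag_mx (\row_j real_complex R (d j)) = 0.
    have := congr1 (fun M => map_mx (real_complex R) M *m P^t*) vS.
    rewrite map_mxM SE map_mx0 mul0mx => <-.
    by rewrite /w !mulmxA -[RHS]mulmxA PPt mulmx1.
  move=> /rowP/(_ j)/eqP; rewrite mul_mx_diag !mxE mulf_eq0 => /orP[/eqP//|/eqP].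
  by case=> dj; have := ld _ jj0; rewrite dj leNgt l0.
have w0 : w 0 j0 != 0.
  apply: contra_neq v0 => w0; apply/eqP; rewrite -(map_mx_eq0 (real_complex R)); apply/eqP.
  rewrite -[LHS]mulmx1 -PtP mulmxA -/w.
  suff -> : w = 0 by rewrite mul0mx.
  by apply/rowP => j; rewrite [RHS]mxE; have [->|/wj] := eqVneq j j0.
have yj0 : y 0 j0 = 0.
  have := congr1 (map_mx (real_complex R)) uv.
  rewrite map_mx0 map_mxM adj mulmxA -/y -/w => /matrixP/(_ 0 0).
  rewrite row_dotE (bigD1 j0) //= big1 ?addr0 => [|j /wj wj0]; last first.
    by rewrite wj0 rmorph0 mulr0.
  by rewrite [in RHS]mxE => /eqP; rewrite mulf_eq0 conjC_eq0 (negPf w0) orbF => /eqP.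
rewrite -ler_real_complex.
have -> : real_complex R ((u *m S *m u^T) 0 0) =
          \sum_j real_complex R (d j) * `|y 0 j| ^+ 2.
  transitivity ((map_mx (real_complex R) (u *m S *m u^T)) 0 0); first by rewrite [RHS]mxE.
  rewrite !map_mxM SE adj !mulmxA -[_ *m P *m _]mulmxA PPt mulmx1 -/y row_dotE.
  apply: eq_bigr => j _; rewrite mul_mx_diag [X in X * _]mxE [X in _ * X * _]mxE.
  by rewrite normCK [y 0 j * _]mulrC !mulrA.
have -> : real_complex R (lambda2 S * (u *m u^T) 0 0) =
          \sum_j real_complex R (lambda2 S) * `|y 0 j| ^+ 2.
  rewrite -mulr_sumr rmorphM /=; congr (_ * _).
  transitivity ((map_mx (real_complex R) (u *m u^T)) 0 0); first by rewrite [RHS]mxE.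
  rewrite !map_mxM adj !mulmxA -/y row_dotE.
  by apply: eq_bigr => j _; rewrite normCK.
apply: ler_sum => j _.
have [->|/ld dj] := eqVneq j j0; first by rewrite yj0 normr0 expr0n /= !mulr0.
by rewrite ler_wpM2r ?exprn_ge0 // ler_real_complex.
Qed.

(** * Spectral gap of a reversible generator *)
Lemma sum_enum_val (R : realType) (X : finType) (F : X -> R) :
  \sum_(i < #|X|) F (enum_val i) = \sum_x F x.
Proof. by rewrite -big_enum_val. Qed.

Lemma lambda2_char_poly (R : realType) n (A B : 'M[R]_n) :
  char_poly A = char_poly B -> lambda2 A = lambda2 B.
Proof. by rewrite /lambda2 /eigenvalues => ->. Qed.

(** Conjugating -M by the diagonal matrix of the square roots of w gives a
    symmetric matrix with the same spectrum, whose kernel contains sqrt w; a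
    signed measure nu of total mass 0 becomes nu / sqrt w, orthogonal to
    sqrt w. *)
Lemma reversible_gap (R : realType) (X : finType) (w : X -> R)
    (M : X -> X -> R) (nu : X -> R) (x0 : X) :
  (forall x, 0 < w x) -> (forall x y, w x * M x y = w y * M y x) ->
  (forall x, \sum_y M x y = 0) -> \sum_x nu x = 0 ->
  0 < lambda2 (- mx_of M) ->
  \sum_y nu y * (\sum_z nu z * M z y) / w y <=
    - lambda2 (- mx_of M) * \sum_y nu y ^+ 2 / w y.
Proof.
move=> w0 rev row0 nu0 l0.
pose s x := Num.sqrt (w x).
have s0 x : 0 < s x by rewrite sqrtr_gt0.
have ss x : s x * s x = w x by rewrite -expr2 sqr_sqrtr ?ltW.
have sN x : s x != 0 by rewrite gt_eqF.
pose S : 'M[R]_#|X| :=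
  \matrix_(i, j) (s (enum_val i) * - M (enum_val i) (enum_val j) / s (enum_val j)).
pose v : 'rV[R]_#|X| := \row_i s (enum_val i).
pose u : 'rV[R]_#|X| := \row_i (nu (enum_val i) / s (enum_val i)).
have lE : lambda2 (- mx_of M) = lambda2 S.
  apply/lambda2_char_poly/(@char_poly_similar _ _ (diag_mx v)).
    rewrite unitmxE det_diag unitfE; apply/prodf_neq0 => i _; rewrite mxE; exact: sN.
  rewrite mul_diag_mx mul_mx_diag; apply/matrixP => i j; rewrite !mxE.
  by rewrite divfK.
rewrite lE in l0 *.
have uu : (u *m u^T) 0 0 = \sum_y nu y ^+ 2 / w y.
  rewrite mxE -[RHS]sum_enum_val; apply: eq_bigr => i _; rewrite !mxE -ss.
  by field.
have uSu : (u *m S *m u^T) 0 0 = - \sum_y nu y * (\sum_z nu z * M z y) / w y.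
  rewrite mxE -sumrN -[RHS]sum_enum_val; apply: eq_bigr => j _; rewrite 2!mxE.
  rewrite -[in RHS]sum_enum_val mulr_sumr !mulr_suml -sumrN; apply: eq_bigr => i _.
  by rewrite !mxE -ss; field; rewrite !sN.
rewrite mulNr lerNr -uSu -uu; apply: (@symmetric_gap _ _ _ _ v) => //.
- apply/matrixP => i j; rewrite !mxE.
  have := rev (enum_val i) (enum_val j); rewrite -!ss => h.
  apply: (mulIf (sN (enum_val i))); apply: (mulIf (sN (enum_val j))).
  rewrite divfK // [RHS]mulrAC divfK //.
  by rewrite !mulrN !mulNr; congr (- _); rewrite mulrAC -h; ring.
- apply/eqP => /rowP/(_ (enum_rank x0)); rewrite !mxE; exact/eqP.
- apply/rowP => j; rewrite !mxE.
  transitivity (- (\sum_x w x * M x (enum_val j)) / s (enum_val j)).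
    rewrite -[in RHS]sum_enum_val mulNr mulr_suml -sumrN; apply: eq_bigr => i _; rewrite !mxE -ss; ring.
  under eq_bigr do rewrite rev.
  by rewrite -mulr_sumr row0 mulr0 oppr0 mul0r.
- apply/matrixP => i j; rewrite !ord1 !mxE -[RHS]nu0 -[RHS]sum_enum_val.
  by apply: eq_bigr => k _; rewrite !mxE divfK.
Qed.

(** * Chi-square distance to a fixed distribution *)
Lemma cauchy_schwarz (R : realType) (X : finType) (a b : X -> R) :
  (\sum_x a x * b x) ^+ 2 <= (\sum_x a x ^+ 2) * (\sum_x b x ^+ 2).
Proof.
(* Lagrange's identity *)
have : 0 <= \sum_x \sum_y (a x * b y - a y * b x) ^+ 2.
  by apply: sumr_ge0 => x _; apply: sumr_ge0 => y _; exact: sqr_ge0.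
have -> : \sum_x \sum_y (a x * b y - a y * b x) ^+ 2 =
  \sum_x \sum_y (a x ^+ 2 * b y ^+ 2 + b x ^+ 2 * a y ^+ 2
                 + (a x * b x) * (a y * b y) *- 2).
  by apply: eq_bigr => x _; apply: eq_bigr => y _; ring.
have sep (f g : X -> R) : \sum_x \sum_y f x * g y = (\sum_x f x) * \sum_y g y.
  by rewrite mulr_suml; apply: eq_bigr => x _; rewrite mulr_sumr.
under eq_bigr do rewrite !big_split /= sumrN sumrMnl.
rewrite !big_split /= sumrN sumrMnl !sep; lra.
Qed.

Lemma ler_sum_sqrt (R : realType) (X : finType) (a b : X -> R) :
  \sum_x a x * b x <= Num.sqrt (\sum_x a x ^+ 2) * Num.sqrt (\sum_x b x ^+ 2).
Proof.
apply: le_trans (ler_norm _) _; rewrite -sqrtr_sqr -sqrtrM ?ler_wsqrtr ?cauchy_schwarz //.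
by apply: sumr_ge0 => x _; exact: sqr_ge0.
Qed.

Section ChiSquare.
Variables (R : realType) (X : finType) (p mu : X -> R).
Hypotheses (p_gt0 : forall x, 0 < p x) (p1 : \sum_x p x = 1).
Hypothesis mu1 : \sum_x mu x = 1.

Definition chi2 : R := \sum_x mu x ^+ 2 / p x - 1.

Lemma chi2E : chi2 = \sum_x (mu x - p x) ^+ 2 / p x.
Proof.
transitivity (\sum_x (mu x ^+ 2 / p x - 2 * mu x + p x)).
  rewrite big_split sumrB -mulr_sumr mu1 p1 /chi2 /=; ring.
by apply: eq_bigr => x _; field; rewrite gt_eqF.
Qed.

Lemma chi2_ge0 : 0 <= chi2.
Proof. by rewrite chi2E; apply: sumr_ge0 => x _; rewrite divr_ge0 ?sqr_ge0 ?ltW. Qed.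

(** Cauchy-Schwarz in L^2(p): the difference of the expectations of f under mu
    and under p is controlled by the chi-square distance. *)
Lemma chi2_test (f : X -> R) :
  \sum_x (mu x - p x) * f x <= Num.sqrt chi2 * Num.sqrt (\sum_x p x * f x ^+ 2).
Proof.
have -> : \sum_x (mu x - p x) * f x =
  \sum_x ((mu x - p x) / Num.sqrt (p x)) * (Num.sqrt (p x) * f x).
  by apply: eq_bigr => x _; rewrite mulrA divfK // gt_eqF // sqrtr_gt0.
apply: le_trans (ler_sum_sqrt _ _) _; rewrite chi2E.
rewrite le_eqVlt; apply/orP; left; apply/eqP; congr (Num.sqrt _ * Num.sqrt _).
  by apply: eq_bigr => x _; rewrite exprMn exprVn sqr_sqrtr ?ltW.
by apply: eq_bigr => x _; rewrite exprMn sqr_sqrtr ?ltW.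
Qed.

(** The quadratic form keeps its value when mu is replaced by mu - p in either
    place, because p M = 0 by reversibility and the rows of M sum to 0; and
    mu - p has total mass 0. *)
Lemma chi2_dissipation (M : X -> X -> R) (x0 : X) :
  (forall x y, p x * M x y = p y * M y x) -> (forall x, \sum_y M x y = 0) ->
  0 < lambda2 (- mx_of M) ->
  \sum_y mu y * (\sum_z mu z * M z y) / p y <= - lambda2 (- mx_of M) * chi2.
Proof.
move=> rev row0 l0; rewrite chi2E.
have inv y : \sum_z p z * M z y = 0.
  under eq_bigr do rewrite rev.
  by rewrite -mulr_sumr row0 mulr0.
have nuM y : \sum_z mu z * M z y = \sum_z (mu z - p z) * M z y.
  by under [RHS]eq_bigr do rewrite mulrBl; rewrite sumrB inv subr0.
have tot0 : \sum_y \sum_z (mu z - p z) * M z y = 0.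
  rewrite exchange_big big1 // => z _; by rewrite -mulr_sumr row0 mulr0.
have -> : \sum_y mu y * (\sum_z mu z * M z y) / p y =
    \sum_y (mu y - p y) * (\sum_z (mu z - p z) * M z y) / p y.
  rewrite -[LHS]subr0 -[X in _ - X]tot0 -sumrB; apply: eq_bigr => y _.
  by rewrite nuM; field; rewrite gt_eqF.
apply: reversible_gap => //.
by rewrite sumrB mu1 p1 subrr.
Qed.

(** With f = mu / p and g = f - 1, expand f^2 = 1 + 2 g + g^2 against U - m,
    which has p-mean 0.  The linear term is a covariance, the quadratic one is
    at most r h since U - m <= r. *)
Lemma chi2_drift (U : X -> R) (r : R) (m := \sum_x p x * U x) :
  (forall x, 0 <= U x <= r) ->
  \sum_x mu x ^+ 2 / p x * (U x - m) <=
    r * chi2 + 2 * (Num.sqrt chi2 * Num.sqrt (\sum_x p x * U x ^+ 2)).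
Proof.
move=> Ur.
have m0 : 0 <= m by apply: sumr_ge0 => x _; case/andP: (Ur x) => U0 _; rewrite mulr_ge0 // ltW.
have -> : \sum_x mu x ^+ 2 / p x * (U x - m) =
    \sum_x (mu x - p x) ^+ 2 / p x * (U x - m) + 2 * \sum_x (mu x - p x) * U x.
  transitivity (\sum_x ((mu x - p x) ^+ 2 / p x * (U x - m) + 2 * ((mu x - p x) * U x) +
     (p x * U x - (2 * mu x - p x) * m))).
    by apply: eq_bigr => x _; field; rewrite gt_eqF.
  rewrite !big_split /= -mulr_sumr sumrN -mulr_suml sumrB -mulr_sumr mu1 p1 -/m.
  by ring.
rewrite lerD // ?ler_pM2l // ?chi2_test //.
rewrite chi2E mulr_sumr; apply: ler_sum => x _; rewrite [leRHS]mulrC ler_wpM2l //.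
  by rewrite divr_ge0 ?sqr_ge0 ?ltW.
by case/andP: (Ur x) => _; lra.
Qed.

End ChiSquare.

(** * Energy landscape *)
Lemma big_selective_mem (T : eqType) (op : T -> T -> T) (a : T) (s : seq T) :
  (forall x y, op x y = x \/ op x y = y) ->
  \big[op/a]_(x <- s) x \in a :: s.
Proof.
move=> sel; elim: s => [|b s IH]; first by rewrite big_nil mem_head.
rewrite big_cons; case: (sel b (\big[op/a]_(x <- s) x)) => ->.
  by rewrite !inE eqxx orbT.
by move: IH; rewrite !inE => /orP[->//|->]; rewrite !orbT.
Qed.

Lemma seqmax_mem (R : realType) (s : seq R) : s != [::] -> seqmax s \in s.
Proof.
case: s => // a s _; have : seqmax (a :: s) \in [:: a, a & s].
  by apply: big_selective_mem => x y; rewrite /Num.max; case: ifP; [right|left].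
by rewrite !inE orbA orbb.
Qed.

Lemma seqmin_mem (R : realType) (s : seq R) : s != [::] -> seqmin s \in s.
Proof.
case: s => // a s _; have : seqmin (a :: s) \in [:: a, a & s].
  by apply: big_selective_mem => x y; rewrite /Num.min; case: ifP; [left|right].
by rewrite !inE orbA orbb.
Qed.

Lemma seqmin_le (R : realType) (s : seq R) a : a \in s -> seqmin s <= a.
Proof.
rewrite /seqmin; move: (head 0 s) => h; elim: s => // b s IH.
rewrite inE big_cons ge_min => /orP[/eqP->|/IH ->]; by rewrite ?lexx ?orbT.
Qed.

Lemma seqmax_ge (R : realType) (s : seq R) a : a \in s -> a <= seqmax s.
Proof.
rewrite /seqmax; move: (head 0 s) => h; elim: s => // b s IH.
rewrite inE big_cons le_max => /orP[/eqP->|/IH ->]; by rewrite ?lexx ?orbT.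
Qed.

Section Energy.
Variables (R : realType) (X : finType) (U : X -> R).

Lemma minU_le x : minU U <= U x.
Proof. by apply: seqmin_le; apply/codomP; exists x. Qed.

Lemma maxU_ge x : U x <= maxU U.
Proof. by apply: seqmax_ge; apply/codomP; exists x. Qed.

Lemma minU_attained (x0 : X) : exists x, x \in Umin U.
Proof.
have : minU U \in codom U.
  apply: seqmin_mem; rewrite -size_eq0 size_codom -lt0n; apply/card_gt0P.
  by exists x0.
by case/codomP => x mE; exists x; rewrite inE mE.
Qed.

Lemma gap_U_le x : x \notin Umin U -> gap_U U <= U x - minU U.
Proof.
move=> xU; rewrite lerD2r; apply: seqmin_le; apply/mapP.
by exists x => //; rewrite mem_enum inE.
Qed.

Lemma elev2_eq0 x p : (forall y, U y = 0) -> elev2 U x p = 0.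
Proof.
move=> U0; rewrite /elev2; set s := map _ _.
have s0 a : a \in s -> a = 0 by case/mapP => e _ ->; rewrite !U0 minxx.
have [->|/seqmax_mem/s0//] := eqVneq s [::].
by rewrite /seqmax big_nil.
Qed.

Lemma cM2_eq0 Q : irreducible Q -> (forall y, U y = 0) -> cM2 U Q = 0.
Proof.
move=> irr U0; rewrite /cM2; set s := image_mem _ _.
have [->|/seqmax_mem] := eqVneq s [::]; first by rewrite /seqmax big_nil.
case/mapP => -[x y] _ -> /=; rewrite !U0 !subr0 /H2.
have [p xyp] := irr x y.
suff -> : [set elev2 U x p | p in Qpaths Q x y] = [set 0] by rewrite inf1.
apply/seteqP; split => [_ [q _ <-]|_ ->] /=; first by rewrite elev2_eq0.
by exists p => //; rewrite elev2_eq0.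
Qed.

(** If every state were a ground state, U would vanish identically, and with
    it every elevation. *)
Lemma nonground_of_cM2_gt0 Q : irreducible Q -> minU U = 0 -> 0 < cM2 U Q ->
  exists x, x \notin Umin U.
Proof.
move=> irr m0 c0; apply/existsP; apply: contraLR c0; rewrite negb_exists.
move=> /forallP allU; rewrite cM2_eq0 ?ltxx // => y.
by have := allU y; rewrite negbK inE m0 => /eqP.
Qed.

End Energy.

(** * Gibbs distributions *)
Section Gibbs.
Variables (R : realType) (X : finType) (U pi : X -> R).

Definition gibbs_weight (b : R) (x : X) : R := pi x * expR (- (b * U x)).
Definition partition_function (b : R) : R := \sum_x gibbs_weight b x.
Definition gibbs (b : R) (x : X) : R := gibbs_weight b x / partition_function b.

Hypotheses (pi_gt0 : forall x, 0 < pi x) (pi1 : \sum_x pi x = 1).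

Lemma gibbs_weight_gt0 b x : 0 < gibbs_weight b x.
Proof. by rewrite mulr_gt0 ?expR_gt0. Qed.

Lemma distribution_inhabited : exists x : X, true.
Proof.
apply/existsP; apply: contraT; rewrite negb_exists => /forallP none.
have := pi1; rewrite big1 => [/eqP|x _]; first by rewrite eq_sym oner_eq0.
by have := none x.
Qed.

Lemma partition_function_gt0 b : 0 < partition_function b.
Proof.
have [x _] := distribution_inhabited.
rewrite /partition_function (bigD1 x) //= ltr_pwDl ?gibbs_weight_gt0 //.
by apply: sumr_ge0 => y _; apply/ltW/gibbs_weight_gt0.
Qed.

Lemma gibbs_gt0 b x : 0 < gibbs b x.
Proof. by rewrite divr_gt0 ?gibbs_weight_gt0 ?partition_function_gt0. Qed.

Lemma sum_gibbs b : \sum_x gibbs b x = 1.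
Proof. by rewrite -mulr_suml divff // gt_eqF // partition_function_gt0. Qed.

Lemma gibbs0 x : gibbs 0 x = pi x.
Proof.
have gw y : gibbs_weight 0 y = pi y by rewrite /gibbs_weight mul0r oppr0 expR0 mulr1.
by rewrite /gibbs /partition_function (eq_bigr pi) // pi1 divr1 gw.
Qed.

Lemma pi_Umin_gt0 : 0 < \sum_(x in Umin U) pi x.
Proof.
have [x0 _] := distribution_inhabited.
have [x xU] := minU_attained U x0.
by rewrite (bigD1 x) //= ltr_pwDl ?pi_gt0 // sumr_ge0 // => y _; apply/ltW.
Qed.

Lemma K_ofE : K_of U pi = (\sum_(x | x \notin Umin U) pi x) / \sum_(x in Umin U) pi x.
Proof.
have -> : \sum_(x | x \notin Umin U) pi x = 1 - \sum_(x in Umin U) pi x.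
  by rewrite -pi1 [in RHS](bigID (mem (Umin U))) /= addrAC subrr add0r.
by rewrite mulrBl mul1r divff // gt_eqF // pi_Umin_gt0.
Qed.

Lemma K_of_ge0 : 0 <= K_of U pi.
Proof.
by rewrite K_ofE divr_ge0 ?(ltW pi_Umin_gt0) // sumr_ge0 // => x _; apply: ltW.
Qed.

(** Excited weights are at most pi(x) exp(-b B), while the partition function
    is at least the mass of the ground states, whose weights are pi(x). *)
Lemma gibbs_tail b : minU U = 0 -> 0 <= b ->
  \sum_(x | x \notin Umin U) gibbs b x <= K_of U pi * expR (- (b * gap_U U)).
Proof.
move=> m0 b0; rewrite -mulr_suml K_ofE mulrAC ler_pM //.
- by apply: sumr_ge0 => x _; apply/ltW/gibbs_weight_gt0.
- by rewrite invr_ge0 ltW // partition_function_gt0.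
- rewrite mulr_suml; apply: ler_sum => x /gap_U_le; rewrite m0 subr0 => Bx.
  by rewrite ler_pM2l // ler_expR lerN2 ler_wpM2l.
rewrite lef_pV2 ?posrE ?pi_Umin_gt0 ?partition_function_gt0 //.
rewrite /partition_function [leRHS](bigID (mem (Umin U))) /=.
rewrite -[leLHS]addr0 lerD //; last first.
  by apply: sumr_ge0 => x _; apply/ltW/gibbs_weight_gt0.
rewrite le_eqVlt; apply/orP; left; apply/eqP; apply: eq_bigr => x.
by rewrite inE m0 => /eqP Ux; rewrite /gibbs_weight Ux mulr0 oppr0 expR0 mulr1.
Qed.

(** U^2 vanishes on the ground states and is at most the squared range of U
    elsewhere, so [gibbs_tail] applies. *)
Lemma gibbs_second_moment b : minU U = 0 -> 0 <= b ->
  Num.sqrt (\sum_x gibbs b x * U x ^+ 2) <=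
    range_U U * (Num.sqrt (K_of U pi) * expR (- (b * gap_U U) / 2)).
Proof.
move=> m0 b0.
have [x0 _] := distribution_inhabited.
have r0 : 0 <= range_U U by rewrite subr_ge0; apply: le_trans (minU_le U x0) (maxU_ge U x0).
rewrite -[leRHS]ger0_norm ?mulr_ge0 ?sqrtr_ge0 ?expR_ge0 // -sqrtr_sqr ler_wsqrtr //.
rewrite !exprMn sqr_sqrtr ?K_of_ge0 //.
have -> : expR (- (b * gap_U U) / 2) ^+ 2 = expR (- (b * gap_U U)).
  by rewrite expr2 -expRD; congr expR; field.
apply: le_trans (ler_wpM2l (sqr_ge0 _) (gibbs_tail m0 b0)).
rewrite mulr_sumr (bigID (mem (Umin U))) /= big1 ?add0r => [|x]; last first.
  by rewrite inE m0 => /eqP->; rewrite expr0n mulr0.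
apply: ler_sum => x _; rewrite mulrC ler_wpM2r ?(ltW (gibbs_gt0 _ _)) //.
have Ux0 : 0 <= U x by rewrite -m0 minU_le.
by rewrite lerXn2r ?nnegrE // /range_U m0 subr0 maxU_ge.
Qed.

(** Multiplied by exp(-b U(x)), the acceptance factor becomes the symmetric
    max(exp(-b U(x)), exp(-b U(y))). *)
Lemma gibbs_reversible Q (T : R -> \bar R) t (x y : X) :
  is_reversible Q pi ->
  gibbs (inv_temp T t) x * M2 U Q T t x y = gibbs (inv_temp T t) y * M2 U Q T t y x.
Proof.
move=> rev; rewrite /M2 eq_sym; have [->//|xy] := eqVneq y x.
rewrite /gibbs ![_ / _ * _]mulrAC; congr (_ / _); rewrite /gibbs_weight.
set b := inv_temp T t.
have half u v : expR (- (b * U u)) * Num.max 1 (expR ((U u - U v) * b)) =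
    Num.max (expR (- (b * U u))) (expR (- (b * U v))).
  by rewrite maxr_pMr ?expR_ge0 // mulr1 -expRD; congr (Num.max _ (expR _)); ring.
transitivity (pi x * Q x y * Num.max (expR (- (b * U x))) (expR (- (b * U y)))).
  by rewrite -half; ring.
by rewrite rev maxC -half; ring.
Qed.

End Gibbs.

Lemma M2_row_sum (R : realType) (X : finType) (U : X -> R) Q T t x :
  \sum_y M2 U Q T t x y = 0.
Proof.
rewrite (bigD1 x) //= {1}/M2 eqxx addrC; apply/eqP; rewrite subr_eq0; apply/eqP.
by apply: eq_bigr => y yx; rewrite /M2 eq_sym (negPf yx).
Qed.

(** Detailed balance propagates positivity of pi along paths. *)
Lemma stationary_gt0 (R : realType) (X : finType) (Q : X -> X -> R) pi :
  irreducible Q -> is_distribution pi -> is_reversible Q pi ->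
  (forall x, 0 < pi x).
Proof.
move=> irr [pi0 pi1] rev.
have [x px] : exists x, 0 < pi x.
  apply/existsP; apply: contraT; rewrite negb_exists => /forallP none.
  have := pi1; rewrite big1 => [/eqP|x _]; first by rewrite eq_sym oner_eq0.
  by apply/le_anti; rewrite pi0 andbT leNgt none.
move=> y; have [p [+ <-]] := irr x y.
elim: p x px => //= z p IH x px /andP[Qxz]; apply: IH.
rewrite lt_neqAle pi0 andbT eq_sym; apply/eqP => pz.
have := rev x z; rewrite pz mul0r => /eqP.
by rewrite mulf_eq0 !gt_eqF.
Qed.

(** * A differential inequality for the square root *)
Lemma nonincreasing_from0 (R : realType) (f df : R -> R) :
  {within `[0, +oo[, continuous f} ->
  (forall t : R, 0 < t -> is_derive t 1 f (df t)) ->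
  (forall t, 0 < t -> df t <= 0) -> forall t, 0 <= t -> f t <= f 0.
Proof.
move=> cf df0 dle t t0; apply: (@ler0_derive1_nincry _ _ 0) => // s.
  by rewrite in_itv /= andbT => s0; have [] := df0 s s0.
by rewrite in_itv /= andbT => s0; rewrite derive1E; have [_ ->] := df0 s s0; exact: dle.
Qed.

(** Formally u = sqrt h satisfies u' <= b' (- r u + r k exp(-b g / 2)).  As h may
    vanish, the argument is run for sqrt (h + e^2) with e > 0 arbitrary: since
    2 r - g >= r, the function
    exp(r b) (sqrt (h + e^2) - e) - 2 k exp((r - g / 2) b) is nonincreasing. *)
Lemma sqrt_gronwall (R : realType) (h dh b db : R -> R) (r k g : R) :
  0 <= r -> g <= r -> 0 <= k -> b 0 = 0 ->
  {within `[0, +oo[, continuous h} -> {within `[0, +oo[, continuous b} ->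
  (forall t, 0 <= t -> 0 <= h t) ->
  (forall t : R, 0 < t -> is_derive t 1 h (dh t)) ->
  (forall t : R, 0 < t -> is_derive t 1 b (db t)) ->
  (forall t, 0 < t -> 0 <= db t) ->
  (forall t, 0 < t -> dh t <=
     2 * db t * (- r * h t + r * k * expR (- (b t * g) / 2) * Num.sqrt (h t))) ->
  forall t, 0 <= t ->
    Num.sqrt (h t) <= expR (- (r * b t)) * Num.sqrt (h 0)
                      + 2 * k * expR (- (b t * g) / 2).
Proof.
move=> r0 gr k0 b0 ch cb h0 derh derb db0 dhle t t0.
apply/ler_addgt0Pr => e e0.
pose q s := Num.sqrt (h s + e ^+ 2).
have he s : 0 <= s -> 0 < h s + e ^+ 2 by move=> s0; rewrite ltr_wpDl ?h0 ?exprn_gt0.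
have q0 s : 0 <= s -> 0 < q s by move=> s0; rewrite sqrtr_gt0 he.
pose F s := expR (r * b s) * (q s - e) - 2 * k * expR ((r - g / 2) * b s).
pose dF s := expR (r * b s) * (r * db s) * (q s - e)
  + expR (r * b s) * ((2 * q s)^-1 * dh s)
  - 2 * k * (expR ((r - g / 2) * b s) * ((r - g / 2) * db s)).
have cF : {within `[0, +oo[, continuous F}.
  have cexp a : {within `[0, +oo[, continuous (fun s => expR (a * b s))}.
    apply: (@within_continuous_comp R R R _ (fun s => a * b s) expR); first by move=> u _; exact: continuous_expR.
    move=> s; apply: cvgM; [exact: cvg_cst | exact: cb].
  have cq : {within `[0, +oo[, continuous q}.
    apply: (@within_continuous_comp R R R _ (fun s => h s + e ^+ 2) Num.sqrt); first by move=> u _; exact: sqrt_continuous.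
    move=> s; apply: cvgD; [exact: ch | exact: cvg_cst].
  move=> s; apply: cvgB.
    by apply: cvgM; [exact: cexp | apply: cvgB; [exact: cq | exact: cvg_cst]].
  by apply: cvgM; [exact: cvg_cst | exact: cexp].
have derF (s : R) : 0 < s -> is_derive s 1 F (dF s).
  move=> s0; have dh' := derh s s0; have db' := derb s s0.
  have dexp a : is_derive s 1 (fun s => expR (a * b s)) (expR (a * b s) * (a * db s)).
    apply: (@is_derive1_comp _ expR (fun s => a * b s)).
  have dq : is_derive s 1 q ((2 * q s)^-1 * dh s).
    apply: (@is_derive1_comp _ Num.sqrt (fun s => h s + e ^+ 2)).
      exact: (is_derive1_sqrt (he s (ltW s0))).
    rewrite -[dh s]addr0; exact: (is_deriveD dh' (is_derive_cst (e ^+ 2) s 1)).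
  have dEq := is_deriveM (dexp r) (is_deriveB dq (is_derive_cst e s 1)).
  have := is_deriveB dEq (is_deriveZ (2 * k) (dexp (r - g / 2))).
  move=> H; apply: (is_derive_eq H).
  rewrite /dF subr0 /GRing.scale /= -[(q - cst e) s]/(q s - e); ring.
have dF0 (s : R) : 0 < s -> dF s <= 0.
  move=> s0.
  set E := expR (r * b s); set G := expR (- (b s * g) / 2).
  have EG : expR ((r - g / 2) * b s) = E * G by rewrite -expRD; congr expR; field.
  rewrite /dF EG -/E.
  have E0 : 0 < E by exact: expR_gt0.
  have G0 : 0 < G by exact: expR_gt0.
  have qs := q0 s (ltW s0).
  have q2 : q s ^+ 2 = h s + e ^+ 2 by rewrite sqr_sqrtr // ltW // he // ltW.
  have hq : Num.sqrt (h s) <= q s by rewrite ler_wsqrtr // lerDl sqr_ge0.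
  have eq : e <= q s.
    by rewrite -(ger0_norm (ltW e0)) -sqrtr_sqr ler_wsqrtr // lerDr h0 // ltW.
  have step : (2 * q s)^-1 * dh s <= db s * (- r * q s + r * e + r * k * G).
    rewrite mulrC ler_pdivrMr ?mulr_gt0 //; apply: le_trans (dhle s s0) _.
    rewrite -/G [leRHS](_ : _ = 2 * db s * ((- r * q s + r * e + r * k * G) * q s)); last by ring.
    apply: ler_wpM2l; first by rewrite mulr_ge0 ?db0.
    have -> : h s = q s ^+ 2 - e ^+ 2 by rewrite q2 addrK.
    have : 0 <= r * (e * (q s - e)) + r * k * G * (q s - Num.sqrt (q s ^+ 2 - e ^+ 2)).
      rewrite q2 addrK addr_ge0 ?mulr_ge0 ?subr_ge0 ?(ltW e0) ?(ltW G0) //.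
    by lra.
  have -> : E * (r * db s) * (q s - e) + E * ((2 * q s)^-1 * dh s) -
    2 * k * (E * G * ((r - g / 2) * db s)) =
    E * (db s * (r * (q s - e) - (2 * r - g) * k * G) + (2 * q s)^-1 * dh s).
    by field; rewrite gt_eqF.
  rewrite pmulr_rle0 //; apply: le_trans (lerD (lexx _) step) _.
  rewrite -mulrDr.
  have -> : r * (q s - e) - (2 * r - g) * k * G + (- r * q s + r * e + r * k * G) =
    - ((r - g) * (k * G)) by ring.
  by rewrite mulrN oppr_le0 !mulr_ge0 ?db0 ?subr_ge0 // ltW.
have := nonincreasing_from0 cF derF dF0 t0.
rewrite {2}/F b0 !mulr0 expR0 mul1r => Ft.
have F0 : q 0 - e - 2 * k * 1 <= Num.sqrt (h 0).
  have : q 0 <= Num.sqrt (h 0) + e.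
    have s0 := sqrtr_ge0 (h 0).
    rewrite -[leRHS]ger0_norm; last by rewrite addr_ge0 // ltW.
    rewrite -sqrtr_sqr ler_wsqrtr // sqrrD sqr_sqrtr ?h0 // lerD2r lerDl.
    by rewrite mulrn_wge0 // mulr_ge0 // ltW.
  by lra.
have := le_trans Ft F0; rewrite /F.
have -> : expR ((r - g / 2) * b t) = expR (r * b t) * expR (- (b t * g) / 2).
  by rewrite -expRD; congr expR; field.
rewrite expRN => H.
have E0 : 0 < expR (r * b t) by exact: expR_gt0.
have : q t <= (expR (r * b t))^-1 * Num.sqrt (h 0) + 2 * k * expR (- (b t * g) / 2) + e.
  rewrite -(ler_pM2l E0) !mulrDr mulrA divff ?gt_eqF // mul1r; lra.
by apply: le_trans; rewrite ler_wsqrtr // lerDl sqr_ge0.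
Qed.

(** * The chi-square distance along a moving Gibbs distribution *)
Lemma is_derive_bigsum (R : realType) (I : Type) (s : seq I) (f : I -> R -> R)
    (df : I -> R) (t : R) :
  (forall i, is_derive t 1 (f i) (df i)) ->
  is_derive t 1 (fun u => \sum_(i <- s) f i u) (\sum_(i <- s) df i).
Proof.
move=> H; have -> : (fun u => \sum_(i <- s) f i u) = \sum_(i <- s) f i.
  by apply/funext => u; rewrite fct_sumE.
elim/big_ind2 : _ => // [|f1 d1 f2 d2]; first exact: is_derive_cst.
exact: is_deriveD.
Qed.

Lemma cvg_bigsum (R : realType) (T : Type) (F : set_system T) (FF : Filter F)
    (I : Type) (s : seq I) (f : I -> T -> R) (l : I -> R) :
  (forall i, f i u @[u --> F] --> l i) ->
  \sum_(i <- s) f i u @[u --> F] --> \sum_(i <- s) l i.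
Proof.
move=> H; elim: s => [|i s IH].
  by under eq_fun do rewrite big_nil; rewrite big_nil; exact: cvg_cst.
by under eq_fun do rewrite big_cons; rewrite big_cons; apply: cvgD.
Qed.

Section Chi2Flow.
Variables (R : realType) (X : finType) (U pi : X -> R).
Hypotheses (pi_gt0 : forall x, 0 < pi x) (pi1 : \sum_x pi x = 1).

(** Differentiating 1 / p as the product of the partition function and an
    exponential avoids quotients. *)
Lemma inv_gibbsE b x :
  (gibbs U pi b x)^-1 = partition_function U pi b * (expR (b * U x) / pi x).
Proof.
rewrite /gibbs /gibbs_weight invf_div; congr (_ * _).
by rewrite invfM -expRN opprK mulrC.
Qed.

Variables (b : R -> R) (mu : R -> X -> R).

Lemma is_derive_inv_gibbs (t db : R) x :
  is_derive t 1 b db ->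
  is_derive t 1 (fun s => (gibbs U pi (b s) x)^-1)
    (db * (U x - \sum_y gibbs U pi (b t) y * U y) / gibbs U pi (b t) x).
Proof.
move=> hb.
have dexp k : is_derive t 1 (fun s => expR (b s * k)) (expR (b t * k) * (k * db)).
  have -> : (fun s => expR (b s * k)) = expR \o (k \*: b).
    by apply/funext => s /=; rewrite mulrC.
  have -> : expR (b t * k) = expR ((k \*: b) t) by rewrite /= mulrC.
  exact: (is_derive1_comp (is_derive_expR _) (is_deriveZ k hb)).
have dZ : is_derive t 1 (fun s => partition_function U pi (b s))
    (- db * \sum_y gibbs_weight U pi (b t) y * U y).
  have H y : is_derive t 1 (fun s => gibbs_weight U pi (b s) y)
      (- db * (gibbs_weight U pi (b t) y * U y)).
    have := is_deriveZ (pi y) (dexp (- U y)).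
    have -> : (pi y \*: (fun s => expR (b s * - U y))) = (fun s => gibbs_weight U pi (b s) y).
      by apply/funext => s; rewrite /gibbs_weight -mulrN.
    by move=> H; apply: (is_derive_eq H); rewrite /gibbs_weight -mulrN /GRing.scale /=; ring.
  by have := is_derive_bigsum (index_enum X) H; rewrite -mulr_sumr.
have := is_deriveM dZ (is_deriveZ (pi x)^-1 (dexp (U x))).
have -> : (fun s => partition_function U pi (b s)) * ((pi x)^-1 \*: (fun s => expR (b s * U x)))
   = (fun s => (gibbs U pi (b s) x)^-1).
  by apply/funext => s; rewrite inv_gibbsE; congr (_ * _); rewrite mulrC.
move=> H; apply: (is_derive_eq H); rewrite inv_gibbsE /GRing.scale /=.
have -> : \sum_y gibbs U pi (b t) y * U y =
    (\sum_y gibbs_weight U pi (b t) y * U y) / partition_function U pi (b t).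
  by rewrite mulr_suml; apply: eq_bigr => y _; rewrite /gibbs mulrAC.
rewrite -[(pi x)^-1 *: _]/((pi x)^-1 * _).
by field; rewrite !gt_eqF ?partition_function_gt0.
Qed.

Lemma is_derive_chi2 (t db : R) (dmu : X -> R)
    (m := \sum_y gibbs U pi (b t) y * U y) :
  is_derive t 1 b db -> (forall x, is_derive t 1 (mu^~ x) (dmu x)) ->
  is_derive t 1 (fun s => chi2 (gibbs U pi (b s)) (mu s))
    (2 * (\sum_x mu t x * dmu x / gibbs U pi (b t) x)
     + db * \sum_x mu t x ^+ 2 / gibbs U pi (b t) x * (U x - m)).
Proof.
move=> hb hmu.
have H x : is_derive t 1 (fun s => mu s x ^+ 2 / gibbs U pi (b s) x)
    (2 * (mu t x * dmu x / gibbs U pi (b t) x)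
     + db * (mu t x ^+ 2 / gibbs U pi (b t) x * (U x - m))).
  have := is_deriveM (is_deriveX 2 (hmu x)) (is_derive_inv_gibbs x hb).
  move=> H; apply: (is_derive_eq H).
  rewrite /GRing.scale /= -/m.
  change (((mu^~ x) ^+ 2) t) with (mu t x ^+ 2); ring.
have := is_deriveB (is_derive_bigsum (index_enum X) H) (is_derive_cst (1 : R) t 1).
by rewrite subr0 big_split /= -!mulr_sumr.
Qed.

Lemma within_continuous_chi2 (D : set R) :
  {within D, continuous b} -> (forall x, {within D, continuous (mu^~ x)}) ->
  {within D, continuous (fun s => chi2 (gibbs U pi (b s)) (mu s))}.
Proof.
move=> cb cmu s.
have cexp k : {within D, continuous (fun s => expR (b s * k))}.
  apply: (@within_continuous_comp R R R _ (fun s => b s * k) expR).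
    by move=> u _; exact: continuous_expR.
  by move=> u; apply: cvgM; [exact: cb | exact: cvg_cst].
have -> : (fun s => chi2 (gibbs U pi (b s)) (mu s)) =
  (fun s => \sum_x mu s x ^+ 2 * ((\sum_y pi y * expR (b s * - U y)) * (expR (b s * U x) / pi x)) - 1).
  apply/funext => u; rewrite /chi2; congr (_ - _); apply: eq_bigr => x _.
  rewrite inv_gibbsE; congr (_ * (_ * _)); apply: eq_bigr => y _.
  by rewrite /gibbs_weight mulrN.
apply: cvgB; last exact: cvg_cst.
apply: cvg_bigsum => x; apply: cvgM.
  rewrite expr2; under eq_fun do rewrite expr2.
  by apply: cvgM; exact: cmu.
apply: cvgM; last by apply: cvgM; [exact: cexp | exact: cvg_cst].
apply: cvg_bigsum => y; apply: cvgM; [exact: cvg_cst | exact: cexp].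
Qed.

End Chi2Flow.

(** * The logarithmic cooling schedule *)
Section LogSchedule.
Variables (R : realType) (c rho : R).
Hypotheses (c_gt0 : 0 < c) (rho_gt0 : 0 < rho).
Let T (t : R) := (c%:E / (ln (rho * t + 1))%:E)%E.

Definition log_inv_temp (t : R) : R := ln (rho * t + 1) / c.

Lemma rhot1_gt0 t : 0 <= t -> 0 < rho * t + 1.
Proof. by move=> t0; rewrite ltr_wpDl ?ltr01 // mulr_ge0 // ltW. Qed.

(** Also valid where the logarithm vanishes: the temperature is then infinite
    and its inverse 0. *)
Lemma inv_temp_log t : inv_temp T t = log_inv_temp t.
Proof.
rewrite /inv_temp /T /log_inv_temp inver; case: eqP => [->|l0].
  by rewrite gt0_muley ?lte_fin // invey mul0r.
rewrite -EFinM fine_invr invfM invrK mulrC //.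
Qed.

Lemma log_cooling_schedule : cooling_schedule T.
Proof.
have Tfin t : 0 < t -> T t = (c / ln (rho * t + 1))%:E.
  move=> t0; rewrite /T inver gt_eqF ?EFinM // ln_gt0 // ltrDr mulr_gt0 //.
have Tle0 : T 0 = +oo%E.
  by rewrite /T mulr0 add0r ln1 inve0 gt0_muley ?lte_fin.
split.
- move=> t; rewrite le_eqVlt => /predU1P[<-|t0]; first by rewrite Tle0 ltry.
  by rewrite Tfin // lte_fin divr_gt0 // ln_gt0 // ltrDr mulr_gt0.
- move=> s t s0 st; have t0 : 0 < t by exact: le_lt_trans st.
  rewrite Tfin //; move: s0 st; rewrite le_eqVlt => /predU1P[<-|s0] st.
    by rewrite Tle0 ltry.
  rewrite Tfin // lte_fin ltr_pM2l // ltf_pV2 ?posrE ?ln_gt0 ?ltrDr ?mulr_gt0 //.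
  by rewrite ltr_ln ?posrE ?rhot1_gt0 ?(ltW s0) ?(ltW t0) // ltrD2r ltr_pM2l.
- apply: cvg_EFin.
    by exists 0; split=> // t t0; rewrite Tfin.
  apply/cvgr0Pnorm_lt => e e0; exists (Num.max 0 (expR (c / e) / rho)).
  split; first exact: num_real.
  move=> t; rewrite gt_max => /andP[t0 te]; rewrite /= Tfin //=.
  have l0 : 0 < ln (rho * t + 1) by rewrite ln_gt0 // ltrDr mulr_gt0.
  rewrite ger0_norm ?divr_ge0 ?(ltW c_gt0) ?(ltW l0) //.
  rewrite ltr_pdivrMr // mulrC -ltr_pdivrMr //.
  rewrite -ltr_expR lnK ?posrE ?rhot1_gt0 ?(ltW t0) //.
  by move: te; rewrite ltr_pdivrMr // [t * rho]mulrC => te; apply: lt_trans te _; rewrite ltrDl.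
Qed.

Lemma is_derive_log_inv_temp (t : R) : 0 <= t ->
  is_derive t 1 log_inv_temp (rho / (c * (rho * t + 1))).
Proof.
move=> t0.
have d1 := is_deriveD (is_deriveZ rho (is_derive_id t 1)) (is_derive_cst (1 : R) t 1).
have d2 := is_derive1_ln (rhot1_gt0 t0).
have -> : log_inv_temp = c^-1 \*: (@ln R \o (rho \*: id + cst 1)).
  by apply/funext => s; rewrite /log_inv_temp mulrC.
have := is_deriveZ c^-1 (@is_derive1_comp _ (@ln R) _ t _ _ d2 d1).
move=> H; apply: (is_derive_eq H); rewrite addr0 /GRing.scale /=.
by field; rewrite !gt_eqF ?rhot1_gt0.
Qed.

Lemma within_continuous_log_inv_temp : {within `[0, +oo[, continuous log_inv_temp}.
Proof.
apply: derivable_within_continuous => t; rewrite in_itv /= andbT => t0.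
by have [] := is_derive_log_inv_temp t0.
Qed.

Lemma expR_log_inv_temp t a : 0 <= t ->
  expR (- (log_inv_temp t * a)) = (rho * t + 1) `^ (- (a / c)).
Proof.
move=> t0; rewrite /powR gt_eqF ?rhot1_gt0 //; congr expR.
by rewrite /log_inv_temp; field; rewrite gt_eqF.
Qed.

End LogSchedule.

(** * Marginals of the chain *)
Section MarginalLaw.
Variables (R : realType) (X : finType) (d : measure_display).
Variables (Omega : measurableType d) (P : probability Omega R) (Y : Omega -> X).
Hypothesis mY : forall y, measurable [set w | Y w = y].

Lemma prob_finite_pred (p : pred X) :
  P [set w | p (Y w)] = (\sum_(y | p y) P [set w | Y w = y])%E.
Proof.
have H (s : seq X) : uniq s -> measurable [set w | Y w \in s] /\
    P [set w | Y w \in s] = (\sum_(y <- s) P [set w | Y w = y])%E.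
  elim: s => [_|y s IH /= /andP[ys us]].
    have -> : [set w | Y w \in [::]] = set0 by apply/seteqP; split.
    by rewrite big_nil measure0.
  have [ms Ps] := IH us.
  have -> : [set w | Y w \in y :: s] = [set w | Y w = y] `|` [set w | Y w \in s].
    apply/seteqP; split => w /=; rewrite inE.
      by case/predU1P => [->|]; [left|right].
    by case=> [->|->]; rewrite ?eqxx ?orbT.
  split; first exact: measurableU.
  rewrite big_cons measureU //; first by congr (_ + _)%E; exact: Ps.
  by apply/seteqP; split => // w [/= -> ]; rewrite (negPf ys).
have [_] := H (enum p) (enum_uniq p).
rewrite big_enum => <-; congr (P _); apply/seteqP; split => w /=.
  by rewrite mem_enum.
by rewrite mem_enum.
Qed.

End MarginalLaw.

(** The one-time marginals are the finite-dimensional distributions attached to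
    lists of length 1; their total mass 1 is inherited from P. *)
Lemma marginal_law (R : realType) (X : finType) (M : R -> X -> X -> R) (x : X)
    (d : measure_display) (Omega : measurableType d) (P : probability Omega R)
    (Z : R -> Omega -> X) :
  is_markov_chain M x P Z ->
  exists p, transition_function M p /\ forall t, 0 <= t ->
    \sum_y p 0 t x y = 1 /\
    forall q : pred X, P [set w | q (Z t w)] = (\sum_(y | q y) p 0 t x y)%:E.
Proof.
move=> [mZ [p [tp fdd]]]; exists p; split=> // t t0.
have Pp y : P [set w | Z t w = y] = (p 0 t x y)%:E.
  have := fdd [:: (t, y)]; rewrite /= t0 big_cons big_nil /= mulr1 => <- //.
  congr (P _); apply/seteqP; split => w /=.
    by move=> Zy q; rewrite inE => /eqP ->.
  by move=> /(_ (t, y)); apply; rewrite inE.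
have H (q : pred X) : P [set w | q (Z t w)] = (\sum_(y | q y) p 0 t x y)%:E.
  rewrite (prob_finite_pred P (fun y => mZ t y t0)) -sumEFin.
  by apply: eq_bigr => y _; exact: Pp.
split=> //; apply: EFin_inj; rewrite -(H predT) -[RHS](@probability_setT _ _ _ P).
by congr (P _); apply/seteqP; split.
Qed.

(** * Convergence of the annealed chain *)
Section Annealing.
Variables (R : realType) (X : finType) (U : X -> R) (Q : X -> X -> R).
Variables (pi : X -> R) (A : R) (x0 : X).
Hypotheses (minU0 : minU U = 0) (pi_gt0 : forall x, 0 < pi x).
Hypotheses (pi1 : \sum_x pi x = 1) (rev : is_reversible Q pi).
Hypotheses (c_gt0 : 0 < cM2 U Q) (range_gt0 : 0 < range_U U).
Hypotheses (gap_le : gap_U U <= range_U U) (gapA : spectral_gap_constant U Q A).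

Let c := cM2 U Q.
Let rho := 2 * c * A / (3 * range_U U).
Let T (t : R) := (c%:E / (ln (rho * t + 1))%:E)%E.
Let b := log_inv_temp c rho.
Let p t := gibbs U pi (b t).

Variable mu : R -> X -> R.
Hypothesis mu0 : forall y, mu 0 y = (x0 == y)%:R.
Hypothesis mu1 : forall t, 0 <= t -> \sum_y mu t y = 1.
Hypothesis cont_mu : forall y, {within `[0, +oo[, continuous (mu^~ y)}.
Hypothesis deriv_mu : forall (t : R) y, 0 < t ->
  is_derive t 1 (mu^~ y) (\sum_z mu t z * M2 U Q T t z y).

Let A_gt0 : 0 < A. Proof. by case: gapA. Qed.

Lemma rate_gt0 : 0 < rho.
Proof. by rewrite /rho divr_gt0 ?mulr_gt0. Qed.

Let rho_gt0 := rate_gt0.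

(** With b' = rho / (c (rho t + 1)), the left-hand side equals A exp(-c b(t)), that is
    A / (rho t + 1), by the choice of rho. *)
Lemma annealing_gap t : 0 <= t ->
  3 / 2 * range_U U * (rho / (c * (rho * t + 1))) <= lambda2 (- mx_of (M2 U Q T t)).
Proof.
move=> t0; have rt := rhot1_gt0 rho_gt0 t0.
have [_ /(_ T (log_cooling_schedule c_gt0 rho_gt0) t t0)] := gapA.
apply: le_trans.
have -> : - cM2 U Q * inv_temp T t = - ln (rho * t + 1).
  by rewrite inv_temp_log // /log_inv_temp -/c; field; rewrite gt_eqF.
rewrite expRN lnK ?posrE // le_eqVlt; apply/orP; left; apply/eqP.
by rewrite {1}/rho; field; rewrite !gt_eqF.
Qed.

(** Let r be the range of U.  Of the dissipation rate 3 r b', one third absorbs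
    the quadratic part r b' h of the drift; the remaining 2 r b' is what [sqrt_gronwall] uses. *)
Lemma chi2_annealing_derive t (db := rho / (c * (rho * t + 1)))
    (m := \sum_y p t y * U y) (h := chi2 (p t) (mu t)) : 0 < t ->
  2 * (\sum_y mu t y * (\sum_z mu t z * M2 U Q T t z y) / p t y)
   + db * (\sum_y mu t y ^+ 2 / p t y * (U y - m)) <=
  2 * db * (- range_U U * h + range_U U * Num.sqrt (K_of U pi)
            * expR (- (b t * gap_U U) / 2) * Num.sqrt h).
Proof.
move=> t0; have t0' := ltW t0; have rt := rhot1_gt0 rho_gt0 t0'.
have db0 : 0 < db by apply: divr_gt0; [exact: rho_gt0 | exact: mulr_gt0].
have gap := annealing_gap t0'; rewrite -/db in gap.
have pg y : 0 < p t y by exact: gibbs_gt0.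
have ps : \sum_y p t y = 1 by exact: sum_gibbs.
have bt : inv_temp T t = b t by exact: inv_temp_log.
have b0 : 0 <= b t by rewrite divr_ge0 ?(ltW c_gt0) // ln_ge0 // lerDr mulr_ge0 // ltW.
have l0 : 0 < lambda2 (- mx_of (M2 U Q T t)).
  by apply: lt_le_trans gap; apply: mulr_gt0 => //; apply: mulr_gt0 => //; lra.
have prev y z : p t y * M2 U Q T t y z = p t z * M2 U Q T t z y.
  by rewrite /p -bt; apply: gibbs_reversible.
have diss := chi2_dissipation pg ps (mu1 t0') x0 prev (M2_row_sum U Q T t) l0.
have Ur y : 0 <= U y <= range_U U.
  by rewrite /range_U minU0 subr0 -{1}minU0 minU_le maxU_ge.
have drift := chi2_drift pg ps (mu1 t0') Ur.
have var := gibbs_second_moment pi_gt0 pi1 minU0 b0.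
have h0 : 0 <= h by exact: chi2_ge0 (mu1 t0').
rewrite -/h in diss drift; rewrite -/(p t) in var.
have drift' := le_trans drift (lerD (lexx _) (ler_wpM2l (ler0n _ 2) (ler_wpM2l (sqrtr_ge0 h) var))).
have diss' : \sum_y mu t y * (\sum_z mu t z * M2 U Q T t z y) / p t y <=
    - (3 / 2 * range_U U * db) * h.
  by apply: le_trans diss _; rewrite !mulNr lerN2 ler_wpM2r.
apply: le_trans (lerD (ler_wpM2l (ler0n _ 2) diss') (ler_wpM2l (ltW db0) drift')) _.
rewrite le_eqVlt; apply/orP; left; apply/eqP; by field.
Qed.

Lemma annealing_chi2_bound t : 0 <= t ->
  Num.sqrt (chi2 (p t) (mu t)) <=
    expR (- (range_U U * b t)) * Num.sqrt ((pi x0)^-1 - 1)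
    + 2 * Num.sqrt (K_of U pi) * expR (- (b t * gap_U U) / 2).
Proof.
move=> t0.
have b0 : b 0 = 0 by rewrite /b /log_inv_temp mulr0 add0r ln1 mul0r.
have h0 : chi2 (p 0) (mu 0) = (pi x0)^-1 - 1.
  rewrite /chi2 /p b0 (bigD1 x0) //= big1 ?addr0 => [|y yx].
    by rewrite mu0 eqxx expr1n gibbs0 // div1r.
  by rewrite mu0 eq_sym (negPf yx) expr0n mul0r.
rewrite -h0.
apply: (sqrt_gronwall (h := fun s => chi2 (p s) (mu s))
  (dh := fun s => 2 * (\sum_y mu s y * (\sum_z mu s z * M2 U Q T s z y) / p s y)
   + rho / (c * (rho * s + 1)) *
     (\sum_y mu s y ^+ 2 / p s y * (U y - \sum_y p s y * U y)))
  (b := b) (db := fun s => rho / (c * (rho * s + 1)))) => //.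
- exact: ltW.
- apply: within_continuous_chi2 => //; exact: within_continuous_log_inv_temp.
- exact: within_continuous_log_inv_temp.
- by move=> s s0; apply: chi2_ge0 (mu1 s0) => // [y|]; [exact: gibbs_gt0 | exact: sum_gibbs].
- move=> s s0; apply: is_derive_chi2 => //.
    by apply: is_derive_log_inv_temp => //; exact: ltW.
  by move=> y; exact: deriv_mu.
- by move=> s s0; apply: is_derive_log_inv_temp => //; exact: ltW.
- by move=> s s0; rewrite divr_ge0 ?(ltW rho_gt0) // mulr_ge0 ?(ltW c_gt0) // ltW // rhot1_gt0 // ltW.
- by move=> s s0; exact: chi2_annealing_derive.
Qed.

(** Test the chi-square bound against the indicator of the excited states.
    One K comes from the Gibbs mass, two from the forcing term of the
    differential inequality. *)
Lemma annealing_escape t : 0 <= t ->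
  \sum_(y | y \notin Umin U) mu t y <=
    3 * K_of U pi * expR (- (b t * gap_U U)) +
    Num.sqrt ((pi x0)^-1 - 1) * Num.sqrt (K_of U pi)
      * expR (- (b t * (range_U U + gap_U U / 2))).
Proof.
move=> t0; have bound := annealing_chi2_bound t0.
have rt := rhot1_gt0 rho_gt0 t0.
have b0 : 0 <= b t by rewrite divr_ge0 ?(ltW c_gt0) // ln_ge0 // lerDr mulr_ge0 // ltW.
have K0 : 0 <= K_of U pi by exact: K_of_ge0.
set k := Num.sqrt (K_of U pi) in bound *; have k2 : K_of U pi = k ^+ 2 by rewrite sqr_sqrtr.
set G := expR (- (b t * gap_U U) / 2) in bound.
have G2 : expR (- (b t * gap_U U)) = G ^+ 2.
  by rewrite expr2 -expRD; congr expR; field.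
set E := expR (- (range_U U * b t)) in bound.
have EG : expR (- (b t * (range_U U + gap_U U / 2))) = E * G.
  by rewrite -expRD; congr expR; field.
have tail : \sum_(y | y \notin Umin U) p t y <= (k * G) ^+ 2.
  by rewrite exprMn -k2 -G2; exact: gibbs_tail.
have test : \sum_y (mu t y - p t y) * (y \notin Umin U)%:R <=
    Num.sqrt (chi2 (p t) (mu t)) * (k * G).
  apply: le_trans (chi2_test _ _ (mu1 t0) _) _; [|exact: sum_gibbs|].
    by move=> y; exact: gibbs_gt0.
  apply: ler_wpM2l; first exact: sqrtr_ge0.
  rewrite -[leRHS]ger0_norm; last by rewrite mulr_ge0 ?sqrtr_ge0 ?expR_ge0.
  rewrite -sqrtr_sqr ler_wsqrtr //; apply: le_trans tail.
  rewrite [leRHS]big_mkcond le_eqVlt; apply/orP; left; apply/eqP.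
  by apply: eq_bigr => y _; case: ifP; rewrite ?expr1n ?expr0n ?mulr1 ?mulr0.
have -> : \sum_(y | y \notin Umin U) mu t y =
    \sum_(y | y \notin Umin U) p t y + \sum_y (mu t y - p t y) * (y \notin Umin U)%:R.
  rewrite big_mkcond [X in X + _]big_mkcond -big_split /=; apply: eq_bigr => y _.
  by case: ifP => _; rewrite ?mulr1 ?mulr0 ?addr0 // addrC subrK.
rewrite k2 G2 EG.
have kG : 0 <= k * G by rewrite mulr_ge0 ?sqrtr_ge0 ?expR_ge0.
have := ler_wpM2r kG bound.
move: test tail; move: (Num.sqrt (chi2 _ _)) => s test tail bd.
apply: le_trans (lerD tail (le_trans test bd)) _.
rewrite le_eqVlt; apply/orP; left; apply/eqP; ring.
Qed.

End Annealing.

Theorem corollary3p1 (R : realType) (X : finType) (U : X -> R)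
    (Q : X -> X -> R) (pi : X -> R) (A : R) :
  (1 < #|X|)%N ->
  minU U = 0 ->
  is_generator Q ->
  irreducible Q ->
  is_stationary Q pi ->
  is_reversible Q pi ->
  0 < cM2 U Q ->
  spectral_gap_constant U Q A ->
  let c := cM2 U Q in
  let K := K_of U pi in
  let B := gap_U U in
  let rho := 2 * c * A / (3 * range_U U) in
  let T := fun t : R => (c%:E / (ln (rho * t + 1))%:E)%E in
  forall (x : X) (d : measure_display) (Omega : measurableType d)
    (P : probability Omega R) (Z : R -> Omega -> X),
  is_markov_chain (M2 U Q T) x P Z ->
  forall t : R, 0 <= t ->
  (P [set w | Z t w \notin Umin U] <=
    (5 * K * (rho * t + 1) `^ (- (B / c)) +
     ((pi x)^-1 - 1) `^ (1 / 2) * K `^ (1 / 2) *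
       (rho * t + 1) `^ (- ((range_U U + B / 2) / c)))%:E)%E.
Proof.
move=> _ minU0 _ irr [pi_distr _] rev c_gt0 gapA c K B rho T x d Omega P Z chain t t0.
have pi_gt0 := stationary_gt0 irr pi_distr rev.
have pi1 : \sum_y pi y = 1 by case: pi_distr.
have [y yU] := nonground_of_cM2_gt0 irr minU0 c_gt0.
have Uy : minU U < U y.
  by rewrite lt_neqAle minU_le andbT eq_sym; move: yU; rewrite inE.
have range_gt0 : 0 < range_U U by rewrite subr_gt0 (lt_le_trans Uy) // maxU_ge.
have gap_le : gap_U U <= range_U U.
  by apply: le_trans (gap_U_le yU) _; rewrite lerD2r maxU_ge.
have [p [tp law]] := marginal_law chain.
have -> : P [set w | Z t w \notin Umin U] = (\sum_(y | y \notin Umin U) p 0 t x y)%:E.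
  exact: (law t t0).2 (fun y => y \notin Umin U).
rewrite lee_fin.
have esc : \sum_(y | y \notin Umin U) p 0 t x y <= _ :=
  annealing_escape minU0 pi_gt0 pi1 rev c_gt0 range_gt0 gap_le gapA
   (fun y => let: And3 H _ _ := tp 0 x y (lexx 0) in H)
   (fun t t0 => (law t t0).1)
   (fun y => let: And3 _ H _ := tp 0 x y (lexx 0) in H)
   (fun t y => let: And3 _ _ H := tp 0 x y (lexx 0) in H t) t0.
apply: le_trans esc _.
have c0 : 0 < c := c_gt0.
have rho0 : 0 < rho by rewrite divr_gt0 ?mulr_gt0 //; case: gapA.
rewrite !expR_log_inv_temp // !div1r !powR12_sqrt; last first.
- have := pi1; rewrite (bigD1 x) //= => pix.
  rewrite subr_ge0 invf_ge1 // -pix lerDl sumr_ge0 // => z _; exact: ltW.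
- exact: K_of_ge0.
rewrite lerD2r ler_wpM2r ?powR_ge0 // ler_wpM2r ?K_of_ge0 //.
by rewrite ler_nat.
Qed.
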